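(* Assume that $Y\cap\mathbb{Z}^m$ is finite, let $p\in[1,\infty)$, and let $\mathcal{R}:\mathcal{L}^p(\Omega,\mathcal{F},\mathbb{P})\to\mathbb{R}$ be convex and nondecreasing. Define $\mathcal{Q}_{\mathcal{R}}:F_Z\to\mathbb{R}$ by $\mathcal{Q}_{\mathcal{R}}(x):=\mathcal{R}[\mathbb{F}(x)]$. Then: 1. $\mathcal{Q}_{\mathcal{R}}$ is continuous at $x\in F_Z$ if $\mu_Z[D_\varphi(x)]=0$. 2. $\mathcal{Q}_{\mathcal{R}}$ is continuous if the Borel measure $\mu_Z$ is absolutely continuous with respect to the Lebesgue measure. In particular (under this absolute continuity), the problem $\min_{x\in F_Z}\mathcal{R}[\mathbb{F}(x)]$ has an optimal solution whenever $F_Z$ is nonempty and compact.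
   Context: Let $T\in\mathbb{R}^{s\times n}$, $W\in\mathbb{R}^{s\times m}$, $q,d\in\mathbb{R}^m$, and $Y\subseteq\mathbb{R}^m$ with $Y\cap\mathbb{Z}^m\neq\emptyset$. For $t\in\mathbb{R}^s$ let $\Psi(t):=\operatorname{Argmin}_y\{d^\top y \mid Wy\le t,\ y\in Y\cap\mathbb{Z}^m\}$ (the set of minimizers; inequalities are componentwise) and $\varphi(t):=\inf_y\{q^\top y\mid y\in\Psi(t)\}\in\mathbb{R}\cup\{\pm\infty\}$, with $\inf\emptyset=+\infty$; $\operatorname{dom}\varphi$ is the set of $t$ where $\varphi(t)$ is finite. Let $Z:\Omega\to\mathbb{R}^s$ be a random vector on a probability space $(\Omega,\mathcal{F},\mathbb{P})$, $\mu_Z:=\mathbb{P}\circ Z^{-1}$ its distribution, $F_Z:=\{x\in\mathbb{R}^n\mid Tx+z\in\operatorname{dom}\varphi\ \ \forall z\in\operatorname{supp}\mu_Z\}$ the induced feasible set. For $x\in F_Z$ put $\mathbb{F}(x)(\omega):=\varphi(Tx+Z(\omega))$; when $Y\cap\mathbb{Z}^m$ is finite this is an element of $\mathcal{L}^\infty(\Omega,\mathcal{F},\mathbb{P})\subseteq\mathcal{L}^p(\Omega,\mathcal{F},\mathbb{P})$. For $x\in F_Z$, $D_\varphi(x):=\{z\in\mathbb{R}^s\mid\varphi\text{ is discontinuous at }Tx+z\}$. A mapping $\mathcal{R}$ is nondecreasing if $\mathcal{R}[Y_1]\le\mathcal{R}[Y_2]$ whenever $Y_1\le Y_2$ $\mathbb{P}$-almost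 surely. *)

(* Defs.v *)
From HB Require Import structures.
From mathcomp Require Import all_boot all_order all_algebra.
From mathcomp Require Import all_classical all_reals all_analysis.
From mathcomp Require Import measurable_realfun.
Import Order.TTheory GRing.Theory Num.Theory.
Import numFieldNormedType.Exports.

Set Implicit Arguments.
Unset Strict Implicit.
Unset Printing Implicit Defensive.

Local Open Scope classical_set_scope.
Local Open Scope ring_scope.

Lemma measurable_bigcap_fin d (T : measurableType d) (I : finType)
  (F : I -> set T) : (forall i, measurable (F i)) -> measurable (\bigcap_i F i).
Proof.
move=> mF; rewrite -[X in measurable X]setCK setC_bigcap; apply: measurableC.
by apply: fin_bigcup_measurable => // i _; exact: measurableC.
Qed.

(* Matrices, in particular the column vectors 'cV[R]_s standing for R^s, carry
   the Borel sigma-algebra of their norm topology. *)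
Section borel_matrix.
Context (R : realType) (m n : nat).

HB.instance Definition _ := @isMeasurable.Build
  (sigma_display (@open 'M[R]_(m, n))) 'M[R]_(m, n)
  <<s @open 'M[R]_(m, n) >> (@sigma_algebra0 _ setT _)
  (@sigma_algebraC _ _) (@sigma_algebra_bigcup _ setT _).

Lemma open_measurable_mx (U : set 'M[R]_(m, n)) : open U -> measurable U.
Proof. exact: sub_sigma_algebra. Qed.

End borel_matrix.

(* s-dimensional Lebesgue measure on the Borel sets of R^s: the iterated product
   of the one-dimensional one, built on s.-tuple R (whose sigma-algebra is the
   product one) and then transported to 'cV[R]_s. *)
Section lebesgue_tuple_step.
Context (R : realType) (n : nat).
Local Notation RB := (measurableTypeR R).
Variable lam : {sigma_finite_measure set (n.-tuple RB) -> \bar R}.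

Let f (x : RB * n.-tuple RB) := [the n.+1.-tuple RB of x.1 :: x.2].
Let g (t : n.+1.-tuple RB) : RB * n.-tuple RB := (thead t, [tuple of behead t]).

Let mf : measurable_fun setT f.
Proof. by apply: measurable_cons. Qed.

Let mg : measurable_fun setT g.
Proof.
by apply/measurable_fun_pair => /=; [exact: measurable_tnth|exact: measurable_behead].
Qed.

Let gK : cancel g f.
Proof. by move=> t; rewrite [RHS]tuple_eta; apply/val_inj. Qed.

Let fK : cancel f g.
Proof. by case=> x t; rewrite /f /g; congr pair => //; apply/val_inj. Qed.

Definition lebesgue_tuple_cons : set (n.+1.-tuple RB) -> \bar R :=
  pushforward (@lebesgue_measure R \x lam)%E f.

Let m := @measure_function_pushforward__canonical__measure_function_Measure
    _ _ _ _ _ (@lebesgue_measure R \x lam)%E _ mf.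

HB.instance Definition _ := isMeasure.Build _ _ _ lebesgue_tuple_cons
  (@measure0 _ _ _ m) (@measure_ge0 _ _ _ m)
  (@measure_semi_sigma_additive _ _ _ m).

Let sf : sigma_finite setT lebesgue_tuple_cons.
Proof.
have /sigma_finiteP[F [TF ndF Foo]] := sigma_finiteT (@lebesgue_measure R).
have /sigma_finiteP[G [TG ndG Goo]] := sigma_finiteT lam.
exists (fun k => g @^-1` (F k `*` G k)).
  rewrite -preimage_bigcup (_ : \bigcup_k _ = setT) ?preimage_setT//.
  rewrite -setXTT TF TG; apply/seteqP; split=> -[x y]/=.
    by move=> [k _ [? ?]]; split; exists k.
  move=> [[k _ Fkx] [l _ Gly]]; exists (maxn k l) => //; split.
    by move: x Fkx; exact/subsetPset/ndF/leq_maxl.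
  by move: y Gly; exact/subsetPset/ndG/leq_maxr.
move=> k; have [? ?] := Foo k; have [? ?] := Goo k; split.
  by rewrite -[X in measurable X]setTI; apply: mg => //; exact: measurableX.
rewrite /lebesgue_tuple_cons /pushforward -comp_preimage.
rewrite (_ : g \o f = id) ?preimage_id; last by apply/funext => x; exact: fK.
by rewrite product_measure1E// lte_mul_pinfty// ge0_fin_numE.
Qed.

HB.instance Definition _ :=
  Measure_isSigmaFinite.Build _ _ _ lebesgue_tuple_cons sf.

End lebesgue_tuple_step.

Fixpoint lebesgue_tuple (R : realType) (n : nat) :
    {sigma_finite_measure set (n.-tuple (measurableTypeR R)) -> \bar R} :=
  match n with
  | 0 => @dirac _ (0.-tuple (measurableTypeR R)) [tuple] R
  | k.+1 => lebesgue_tuple_cons (lebesgue_tuple R k)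
  end.

Section lebesgue_vec.
Context (R : realType) (s : nat).
Local Notation RB := (measurableTypeR R).

Definition cV_of_tuple (t : s.-tuple RB) : 'cV[R]_s := \col_i tnth t i.

Lemma measurable_cV_of_tuple : measurable_fun setT cV_of_tuple.
Proof.
apply: (measurability (@open 'cV[R]_s)) => // _ [U oU <-]; rewrite setTI.
pose box (a : 'cV[rat]_s * nat) :=
  [set t : s.-tuple RB | forall i, `|tnth t i - ratr (a.1 i 0)| < a.2.+1%:R^-1].
pose D := [set a | box a `<=` cV_of_tuple @^-1` U].
rewrite (_ : _ @^-1` _ = \bigcup_a (if a \in D then box a else set0)).
  apply: countable_bigcupT_measurable => // a; case: ifP => // _.
  rewrite (_ : box a =
    \bigcap_(i : 'I_s) ((fun t : s.-tuple RB => tnth t i) @^-1` [set x : R | `|x - ratr (a.1 i 0)| < a.2.+1%:R^-1])).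
    apply: measurable_bigcap_fin => i.
    rewrite -[X in measurable X]setTI; apply: measurable_tnth => //.
    rewrite (_ : [set x | _] =
      `](ratr (a.1 i 0) - a.2.+1%:R^-1), (ratr (a.1 i 0) + a.2.+1%:R^-1)[%classic).
      exact: measurable_itv.
    by apply/seteqP; split=> x /=; rewrite in_itv/= ltr_distl.
  by apply/seteqP; split=> [t bt i _|t bt i]; apply: bt.
apply/seteqP; split=> [t Ut|t [a _]]; last first.
  by case: ifPn => // /set_mem; apply.
have /nbhs_ballP[e /= e0 eU] : nbhs (cV_of_tuple t) U by exact: open_nbhs_nbhs.
have [k ke] : exists k : nat, k.+1%:R^-1 < e / 2 :> R.
  have e20 : 0 < e / 2 by rewrite divr_gt0.
  have [k _ /(_ k (leqnn _))] := near_infty_natSinv_lt (PosNum e20).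
  by exists k.
have /choice[a ta] (i : 'I_s) : exists r : rat, `|tnth t i - ratr r| < k.+1%:R^-1.
  have k0 : 0 < k.+1%:R^-1 :> R by rewrite invr_gt0.
  have [r] := @rat_in_itvoo R (tnth t i) (tnth t i + k.+1%:R^-1) ltac:(by rewrite ltrDl).
  rewrite in_itv/= => /andP[tr rt]; exists r.
  by rewrite distrC gtr0_norm ?subr_gt0// ltrBlDl.
exists (\col_i a i, k) => //; case: ifPn => [_ i|]; first by rewrite /= mxE; exact: ta.
move/negP; apply; apply/mem_set => u bu /=; apply: eU; split => // i j.
rewrite -ball_normE /= !mxE.
have := bu i; rewrite /= mxE => ui.
rewrite (le_lt_trans (ler_distD (ratr (a i)) _ _))// (splitr e).
by rewrite ltrD// ?(lt_trans _ ke)// distrC.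
Qed.

Definition lebesgue_vec : set 'cV[R]_s -> \bar R :=
  pushforward (lebesgue_tuple R s) cV_of_tuple.

Let m := @measure_function_pushforward__canonical__measure_function_Measure
    _ _ _ _ _ (lebesgue_tuple R s) _ measurable_cV_of_tuple.

HB.instance Definition _ := isMeasure.Build _ _ _ lebesgue_vec
  (@measure0 _ _ _ m) (@measure_ge0 _ _ _ m)
  (@measure_semi_sigma_additive _ _ _ m).

End lebesgue_vec.

Section finitely_many_values.
Context (R : realType) d (Om : measurableType d) (P : probability Om R).

Lemma Lfun_bounded (p : R) (p1 : 1 <= p) (f : Om -> R) (M : R) :
  measurable_fun setT f -> (forall w, `|f w| <= M) -> f \in Lfun P p%:E.
Proof.
move=> mf fM; apply/andP; split; rewrite inE//=.
have p0 : 0 <= p by rewrite (le_trans ler01).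
rewrite /finite_norm unlock poweR_lty//.
apply: (@le_lt_trans _ _ (\int[P]_w (cst (M `^ p)%:E w))%E).
  apply: ge0_le_integral => //=.
  - apply/measurable_EFinP.
    apply: (@measurableT_comp _ _ _ _ _ _ (@powR R ^~ p)) => //.
    exact: measurableT_comp.
  - by move=> w _; rewrite lee_fin ge0_ler_powR// nnegrE// (le_trans _ (fM w)).
by rewrite integral_cst//= probability_setT mule1 ltry.
Qed.

Lemma Lfun_finite_factor (p : R) (p1 : 1 <= p) (I : finType)
    (A : I -> set Om) (G : {ffun I -> bool} -> R) :
  (forall i, measurable (A i)) ->
  (fun w => G [ffun i => w \in A i]) \in Lfun P p%:E.
Proof.
move=> mA; apply: (@Lfun_bounded _ p1 _ (\sum_b `|G b|)); last first.
  by move=> w; rewrite (bigD1 [ffun i => w \in A i])//= lerDl sumr_ge0.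
move=> _ B mB; rewrite setTI.
rewrite (_ : _ @^-1` _ = \bigcup_(b in [set b | B (G b)])
    \bigcap_i (if b i then A i else ~` A i)); last first.
  apply/seteqP; split => [w Bw|w [b /= Bb wb]].
    exists [ffun i => w \in A i] => // i _; rewrite ffunE.
    by case: ifPn => [/set_mem//|/negP wA Aw]; apply: wA; exact/mem_set.
  rewrite /= (_ : [ffun i => _] = b)//; apply/ffunP => i; rewrite ffunE.
  have := wb i Logic.I; case: ifPn => [_ /mem_set//|_ nA].
  by apply/negbTE/negP => /set_mem.
apply: fin_bigcup_measurable => // b _.
by apply: measurable_bigcap_fin => i; case: ifP => // _; exact: measurableC.
Qed.

End finitely_many_values.

Section bilevel_integer_program.
Context (R : realType) (m s : nat).
Variables (W : 'M[R]_(s, m)) (q d : 'cV[R]_m) (Y : set 'cV[R]_m).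

Definition integer_points : set 'cV[R]_m :=
  [set y | forall i, y i 0 \is a Num.int].

Definition dotv (c y : 'cV[R]_m) : R := (c^T *m y) 0 0.

Definition argmin_set (c : 'cV[R]_m) (C : set 'cV[R]_m) : set 'cV[R]_m :=
  [set y | C y /\ forall y', C y' -> dotv c y <= dotv c y'].

Definition lower_feasible (t : 'cV[R]_s) : set 'cV[R]_m :=
  [set y | (forall i, (W *m y) i 0 <= t i 0) /\ (Y `&` integer_points) y].

Definition Psi (t : 'cV[R]_s) : set 'cV[R]_m := argmin_set d (lower_feasible t).

(* The infimum of the empty set is +oo, so phi t = +oo when Psi t is empty. *)
Definition phi (t : 'cV[R]_s) : \bar R :=
  ereal_inf [set (dotv q y)%:E | y in Psi t].

Definition dom_phi : set 'cV[R]_s := [set t | phi t \is a fin_num].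

End bilevel_integer_program.

Definition msupport (R : realType) (s : nat) (mu : set 'cV[R]_s -> \bar R) :
    set 'cV[R]_s :=
  [set z | forall U, open_nbhs z U -> (0 < mu U)%E].

Section stochastic_program.
Context (R : realType) (n m s : nat).
Variables (T : 'M[R]_(s, n)) (W : 'M[R]_(s, m)) (q d : 'cV[R]_m).
Variable Y : set 'cV[R]_m.
Context (disp : measure_display) (Omega : measurableType disp).
Variables (P : probability Omega R) (Z : {RV P >-> 'cV[R]_s}).

Definition F_Z : set 'cV[R]_n :=
  [set x | forall z, msupport (distribution P Z) z ->
     dom_phi W q d Y (T *m x + z)].

Definition D_phi (x : 'cV[R]_n) : set 'cV[R]_s :=
  [set z | ~ {for T *m x + z, continuous (phi W q d Y)}].

(* For x in F_Z the value phi (T x + Z w) is finite for almost every w, namely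
   whenever Z w lies in the support; fine only changes it (to 0) on the remaining
   null set. *)
Definition recourse_fun (x : 'cV[R]_n) (w : Omega) : R :=
  fine (phi W q d Y (T *m x + Z w)).

Lemma recourse_fun_Lfun (p : R) (x : 'cV[R]_n) :
  (1 <= p%:E)%E -> finite_set (Y `&` @integer_points R m) ->
  recourse_fun x \in Lfun P p%:E.
Proof.
rewrite lee_fin => p1 /finite_seqP[ys Yys].
pose A (i : 'I_(size ys)) := [set w : Omega |
  forall j, (W *m ys`_i) j 0 <= (T *m x + Z w) j 0].
pose G (b : {ffun 'I_(size ys) -> bool}) := fine (ereal_inf
  [set (dotv q y)%:E | y in argmin_set d [set y | exists2 i, b i & y = ys`_i]]).
rewrite (_ : recourse_fun x = fun w => G [ffun i => w \in A i]).
  apply: Lfun_finite_factor => // i.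
  rewrite (_ : A i = \bigcap_j (Z @^-1`
      ~` [set z : 'cV[R]_s | z j 0 < (W *m ys`_i - T *m x) j 0])).
    apply: measurable_bigcap_fin => j.
    have /open_measurable_mx/measurableC mU :
        open [set z : 'cV[R]_s | z j 0 < (W *m ys`_i - T *m x) j 0].
      apply: (@open_comp _ _ (fun z : 'cV[R]_s => z j 0) [set r : R | r < _]).
        by move=> z _; exact: coord_continuous.
      exact: open_lt.
    by rewrite -[X in measurable X]setTI; exact: (measurable_funPT Z).
  apply/seteqP; split => w /= Aw j.
    move=> _ /=; apply/negP; rewrite -leNgt !mxE lerBlDl.
    by have := Aw j; rewrite !mxE.
  by have /negP := Aw j Logic.I; rewrite -leNgt !mxE lerBlDl.
apply/funext => w; rewrite /recourse_fun /G /phi /Psi.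
congr (fine (ereal_inf [set _ | _ in argmin_set d _])).
apply/seteqP; split => y.
  move=> -[Wy]; rewrite Yys /= => yys.
  have iy : (index y ys < size ys)%N by rewrite index_mem.
  exists (Ordinal iy); last by rewrite /= nth_index.
  by rewrite ffunE; apply/mem_set => j /=; rewrite nth_index.
move=> [i]; rewrite ffunE => /set_mem Ai ->; split => //.
by rewrite Yys /= mem_nth.
Qed.

Section recourse.
Variables (p : R) (p1 : (1 <= p%:E)%E).
Hypothesis Yfin : finite_set (Y `&` @integer_points R m).

Definition recourse (x : 'cV[R]_n) : LfunType P p1 :=
  Lfun_Sub p1 (recourse_fun_Lfun x p1 Yfin).

Variable risk : LfunType P p1 -> R.

(* Only the values on F_Z are meaningful. *)
Definition Q_R (x : 'cV[R]_n) : R := risk (recourse x).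

End recourse.

End stochastic_program.

(* LfunType P p1 consists of p-integrable functions rather than of their classes
   modulo P-a.e. equality. Since the order below is an a.e. one, a nondecreasing
   risk takes the same value on a.e. equal functions, hence such functionals are
   exactly the nondecreasing functionals on the quotient. *)
Definition ae_nondecreasing (R : realType) d (Omega : measurableType d)
    (P : probability Omega R) (p : \bar R) (p1 : (1 <= p)%E)
    (risk : LfunType P p1 -> R) :=
  forall X1 X2 : LfunType P p1,
    (\forall w \ae P, X1 w <= X2 w) -> risk X1 <= risk X2.

(* Main.v *)
Require Import Defs.
From HB Require Import structures.
From mathcomp Require Import all_boot all_order all_algebra.
From mathcomp Require Import all_classical all_reals all_analysis.
From mathcomp Require Import measurable_realfun.
From mathcomp Require Import lra.
Import Order.TTheory GRing.Theory Num.Theory.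
Import numFieldNormedType.Exports.
Set Implicit Arguments.
Unset Strict Implicit.
Unset Printing Implicit Defensive.
Local Open Scope classical_set_scope.
Local Open Scope ring_scope.

(** The optimal value phi depends on t only through the finite set of integer
    points y with W y <= t, so it has finite range.  For a function of finite
    range, continuity at t means being constant near t, and so at a given x,
    if D_phi x is a null set, then for almost every w the function phi is
    constant on a ball around T x + Z w.  Let A_k be the event that no ball of
    radius at least 1/(k+1) works; these events decrease to a null set
    ([Q_R_continuous_at]), so P (A_k) tends to 0, and F(x') = F(x) outside A_k
    for all x' close enough to x, while |F(x') - F(x)| <= 2B everywhere.

    It remains to see that a real-valued convex nondecreasing risk measure
    cannot tell apart X and X' when |X' - X| <= M 1_(A_k) and k is large
    ([risk_close_off_small_sets]).  This is an elementary form of the automatic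
    continuity of such functionals on the Banach lattice L^p.  Since P (A_k)
    tends to 0, a single H in L^p dominates (i+1) 1_(A_k) for suitable
    k = k(i), whatever i is ([Lfun_unbounded_majorant]); hence
    |X' - X| <= t M H with t = 1/(i+1), and convexity along the segment from X
    to X + M H, together with monotonicity, bounds the change of the risk by t
    times the fixed number risk (X + M H) - risk X
    ([convex_nondecreasing_order_lipschitz]).

    If the law of Z is absolutely continuous, D_phi x is null for every x: a
    discontinuity of phi at t forces t i = (W y) i for some i and one of the
    finitely many integer points y, so D_phi x is covered by finitely many
    hyperplanes, which are Lebesgue null.  A minimizer then exists by
    compactness. *)

(** * Convex nondecreasing functionals on L^p *)

(** Choose k_i with the measure of A_(k_i) so small that
    h = sum_i (i+1)^p 1_(A_(k_i)) is integrable; then H = h^(1/p) lies in L^p,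
    and H >= i+1 almost everywhere on A_(k_i), where h has the term (i+1)^p. *)
Lemma Lfun_unbounded_majorant d (T : measurableType d) (R : realType)
    (mu : {measure set T -> \bar R}) (p : R) (A : (set T)^nat) :
  1 <= p -> (forall k, measurable (A k)) ->
  (forall e, 0 < e -> exists k, (mu (A k) <= e%:E)%E) ->
  exists2 H : T -> R, H \in Lfun mu p%:E &
    forall i, exists k, \forall w \ae mu, i.+1%:R * \1_(A k) w <= H w.
Proof.
move=> p1 mA muA0; have p0 : 0 < p by rewrite (lt_le_trans ltr01).
pose c (i : nat) : R := i.+1%:R `^ p.
have c0 i : 0 < c i by rewrite powR_gt0.
(* This makes the i-th term of h have integral at most 2^-(i+1). *)
have /choice[f fA] (i : nat) :
    exists k, (mu (A k) <= ((c i)^-1 * (1 / (2 ^ i.+1)%:R))%:E)%E.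
  by apply: muA0; rewrite mulr_gt0 ?invr_gt0// divr_gt0// ltr0n expn_gt0.
pose u i w : \bar R := (c i * \1_(A (f i)) w)%:E.
have u0 i w : (0 <= u i w)%E by rewrite lee_fin mulr_ge0// ltW.
have mu_ i : measurable_fun setT (u i).
  by apply/measurable_EFinP/measurable_funM => //; exact: measurable_indic.
pose h w := (\sum_(0 <= i <oo) u i w)%E.
have h0 w : (0 <= h w)%E by exact: nneseries_ge0.
have mh : measurable_fun setT h by exact: ge0_emeasurable_sum.
have hfin : (\int[mu]_w h w <= 1)%E.
  rewrite /h integral_nneseries//.
  apply: (le_trans _ (@epsilon_trick0 R 1 xpredT ler01)).
  apply: lee_nneseries => [i _ _|i _]; first exact: integral_ge0.
  under eq_integral do rewrite /u EFinM.
  rewrite ge0_integralZl//; last 2 first.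
  - exact/measurable_EFinP/measurable_indic.
  - by rewrite lee_fin ltW.
  rewrite integral_indic// setIT.
  have c0E : (0 <= (c i)%:E)%E by rewrite lee_fin ltW.
  have := lee_wpmul2l c0E (fA i).
  by rewrite -EFinM mulVKf// gt_eqF.
have ih : mu.-integrable setT h.
  apply/integrableP; split=> //.
  under eq_integral do rewrite gee0_abs//.
  by rewrite (le_lt_trans hfin)// ltry.
(* Where h is infinite, fine h is 0: H dominates only almost everywhere. *)
have hae := integrable_ae measurableT ih.
have mfh : measurable_fun setT (fine \o h) by exact: measurableT_comp.
exists (fun w => fine (h w) `^ p^-1).
  apply/andP; split; rewrite inE/=.
    by apply: (@measurableT_comp _ _ _ _ _ _ (@powR R ^~ p^-1)).
  rewrite /finite_norm unlock poweR_lty// (@le_lt_trans _ _ 1%E) ?ltry//.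
  apply: le_trans hfin.
  apply: ge0_le_integral => //=.
  - apply/measurable_EFinP.
    apply: (@measurableT_comp _ _ _ _ _ _ (@powR R ^~ p)) => //.
    apply: measurableT_comp => //.
    by apply: (@measurableT_comp _ _ _ _ _ _ (@powR R ^~ p^-1)).
  - move=> w _; rewrite ger0_norm ?powR_ge0// -powRrM mulVf ?gt_eqF// powRr1.
      have [->|hoo] := eqVneq (h w) +oo%E; first by rewrite leey.
      by rewrite fineK// ge0_fin_numE// lt_neqAle hoo leey.
    exact: fine_ge0.
move=> i; exists (f i); apply: filterS hae => w /(_ Logic.I) hw.
have [Aw|Aw] := pselect (A (f i) w); last first.
  by rewrite indicE memNset// mulr0 powR_ge0.
rewrite indicE mem_set// mulr1.
have : (u i w <= h w)%E.
  rewrite /h (nneseries_split 0 i.+1)//.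
  rewrite add0n big_nat_recr//= -addeA addeCA leeDl// adde_ge0//.
    exact: sume_ge0.
  exact: nneseries_ge0.
rewrite -[h w]fineK// lee_fin indicE mem_set// mulr1 => cih.
have := @ge0_ler_powR R p^-1 _ _ _ _ _ cih.
rewrite /c -powRrM mulfV ?gt_eqF// powRr1//.
by apply; rewrite ?nnegrE ?powR_ge0 ?invr_ge0 ?(ltW p0)// fine_ge0.
Qed.

(** Order-theoretic form of the fact that convex functions bounded above are
    locally Lipschitz: the order interval [X - H, X + H] plays the role of a
    ball around X, and monotonicity makes risk (X + H) an upper bound there. *)
Lemma convex_nondecreasing_order_lipschitz (R : realType) d
    (Omega : measurableType d) (P : probability Omega R) (p : \bar R)
    (p1 : (1 <= p)%E) (risk : LfunType P p1 -> R) (X X' H : LfunType P p1)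
    (t : R) :
  convex_function [set: LfunType P p1] risk -> ae_nondecreasing risk ->
  0 < t <= 1 -> (\forall w \ae P, `|X' w - X w| <= t * H w) ->
  `|risk X' - risk X| <= t * (risk (X + H) - risk X).
Proof.
move=> cvx mono /andP[t0 t1] XX'.
have conv (U V : LfunType P p1) (a : R) : 0 <= a <= 1 ->
    risk (a *: U + (1 - a) *: V) <= a * risk U + (1 - a) * risk V.
  by move=> /andP[a0 a1]; have := cvx (Itv01 a0 a1) U V; rewrite !inE /conv /=; apply.
(* X' lies below the point of the segment from X to X + H of parameter t. *)
have le_upper : risk X' <= t * risk (X + H) + (1 - t) * risk X.
  apply: (le_trans _ (conv _ _ _ _)); last by rewrite ltW.
  apply: mono; apply: filterS XX' => w /=.
  rewrite ler_norml => /andP[_].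
  change (X' w - X w <= t * H w -> X' w <= t * (X w + H w) + (1 - t) * X w).
  by lra.
(* X' + t (X + H) >= (1 + t) X, so that X lies below a convex combination of X'
   and X + H with weights 1 / (1 + t) and t / (1 + t). *)
have le_lower : risk X <=
    (1 + t)^-1 * risk X' + (1 - (1 + t)^-1) * risk (X + H).
  apply: (le_trans _ (conv _ _ _ _)); last first.
    by rewrite invr_ge0 invf_le1; lra.
  apply: mono; apply: filterS XX' => w /=.
  rewrite ler_norml => /andP[+ _].
  move=> lo.
  suff : X w <= (1 + t)^-1 * X' w + (1 - (1 + t)^-1) * (X w + H w) by [].
  rewrite -(ler_pM2l (_ : 0 < 1 + t)) ?addr_gt0//.
  rewrite mulrDr !mulrA mulrBr divff ?gt_eqF ?addr_gt0//.
  by nra.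
rewrite ler_norml; apply/andP; split; last by lra.
move: le_lower; rewrite -(ler_pM2l (_ : 0 < 1 + t)) ?addr_gt0//.
rewrite mulrDr !mulrA mulrBr divff ?gt_eqF ?addr_gt0//.
by lra.
Qed.

(** The choice of k depends on X only, and is uniform in X': this is why a plain
    sequence of small sets controls a neighbourhood of decisions x'. *)
Lemma risk_close_off_small_sets (R : realType) d
    (Omega : measurableType d) (P : probability Omega R) (p : R)
    (p1 : (1 <= p%:E)%E) (risk : LfunType P p1 -> R) (X : LfunType P p1)
    (A : (set Omega)^nat) (M e : R) :
  convex_function [set: LfunType P p1] risk -> ae_nondecreasing risk ->
  (forall k, measurable (A k)) -> P (A k) @[k --> \oo] --> 0%E ->
  0 <= M -> 0 < e ->
  exists k, forall X' : LfunType P p1,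
    (forall w, `|X' w - X w| <= M * \1_(A k) w) -> `|risk X' - risk X| <= e.
Proof.
move=> cvx mono mA A0 M0 e0.
have smallA r : 0 < r -> exists k, (P (A k) <= r%:E)%E.
  move=> r0.
  have rN : nbhs (0 : \bar R)%E [set y | (y < r%:E)%E].
    by apply: open_nbhs_nbhs; split; [exact: open_ereal_lt_ereal|rewrite /= lte_fin].
  have [k _ /(_ k (leqnn k)) kr] := A0 _ rN.
  by exists k; exact: ltW.
have p1R : 1 <= p by rewrite -lee_fin.
have [H HL Hmaj] := Lfun_unbounded_majorant p1R mA smallA.
pose H' : LfunType P p1 := Lfun_Sub p1 HL.
pose C := risk (X + M *: H') - risk X.
have [i iC] : exists i : nat, i.+1%:R^-1 * C <= e.
  exists (Num.truncn (C / e)); rewrite mulrC ler_pdivrMr ?ltr0n//.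
  by rewrite -ler_pdivrMl// mulrC ltW// truncnS_gt.
have [k kH] := Hmaj i; exists k => X' XX'.
apply: le_trans iC; apply: convex_nondecreasing_order_lipschitz => //.
  by rewrite invr_gt0 ltr0n/= invf_le1 ?ltr0n// ler1n.
apply: filterS kH => w iH; apply: (le_trans (XX' w)).
suff : M * \1_(A k) w <= i.+1%:R^-1 * (M * H w) by [].
by rewrite mulrCA ler_wpM2l// ler_pdivlMl// ltr0n.
Qed.

(** * Functions of finite range *)

(** The other values of f form a closed set, being finite in a Hausdorff
    space. *)
Lemma finite_range_continuousE (X V : topologicalType) (f : X -> V) (x : X) :
  hausdorff_space V -> finite_set (range f) ->
  {for x, continuous f} <-> \forall y \near x, f y = f x.
Proof.
move=> hV ff; split=> [fx|nx]; last first.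
  by apply: cvg_near_cst.
have cl : closed (range f `\ f x).
  have [+ _] := @accessible_finite_set_closed V; apply.
    exact: hausdorff_accessible.
  exact: finite_setD.
have N : nbhs (f x) (~` (range f `\ f x)).
  by apply: open_nbhs_nbhs; split; [exact: closed_openC|by move=> -[_ ne]; exact: ne].
have fN : \forall y \near x, (~` (range f `\ f x)) (f y) by exact: fx.
apply: filterS fN => y fy.
by apply: contrapT => ne; apply: fy; split => //; exists y.
Qed.

(** The points at distance at least e from the complement of their level set.
    Closedness is what makes the exceptional events of [Q_R_continuous_at]
    measurable. *)
Lemma closed_level_erosion (R : numFieldType) (X : pseudoMetricNormedZmodType R)
    (V : choiceType) (f : X -> V) (e : R) :
  0 < e -> finite_set (range f) ->
  closed [set x | forall y, ball x e y -> f y = f x].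
Proof.
move=> e0 ff.
rewrite (_ : [set _ | _] =
    \bigcup_(c in range f) [set x | forall y, ball x e y -> f y = c]); last first.
  apply/seteqP; split => [x fx|x [_ [z _ <-] xz] y xy].
    by exists (f x) => //; exists x.
  by rewrite (xz y)// (xz x)//; exact: ballxx.
apply: closed_bigcup => // c _.
rewrite -[X in closed X]setCK; apply: open_closedC.
rewrite (_ : ~` _ = \bigcup_(y in [set y | f y <> c]) ball y e).
  by apply: bigcup_open => y _; exact: ball_open.
apply/seteqP; split => [x /existsNP[y /not_implyP[xy fy]]|x [y fy xy] xc].
  by exists y => //; exact: ball_sym.
by apply: fy; apply: xc; exact: ball_sym.
Qed.

Lemma near_mulmx_ball (R : realType) (s n : nat) (T : 'M[R]_(s, n))
    (x : 'cV[R]_n) (e : R) :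
  0 < e -> \forall y \near x, ball (T *m x) e (T *m y).
Proof.
move=> e0.
have : \forall y \near x, forall i : 'I_s, ball ((T *m x) i 0) e ((T *m y) i 0).
  refine (@filter_forall _ _ _ _ (nbhs_filter x) _) => i.
  have cTj j : continuous (fun y : 'cV[R]_n => T i j * y j 0).
    have Cj := @coord_continuous R n 1 j 0.
    by move=> y; exact: (cvgM (cvg_cst (T i j)) (Cj y)).
  have cT : continuous (fun y : 'cV[R]_n => \sum_j T i j * y j 0).
    by apply: continuous_big => [|j _]; [exact: add_continuous|exact: cTj].
  have : nbhs x [set y : 'cV[R]_n |
      ball (\sum_j T i j * x j 0) e (\sum_j T i j * y j 0)].
    by apply: cT; exact: nbhsx_ballx.
  by apply: filterS => y; rewrite !mxE.
by apply: filterS => y xy; split => // i j; rewrite ord1; exact: xy.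
Qed.

Lemma translation_continuous (R : realType) (s : nat) (a : 'cV[R]_s) :
  continuous (fun z : 'cV[R]_s => a + z).
Proof.
move=> z.
exact: (@cvgD R 'cV[R]_s _ (nbhs z) _ (cst a) id _ _ (cvg_cst a) cvg_id).
Qed.

(** * Hyperplanes are Lebesgue null *)

Lemma measurable_tnth_eq (R : realType) (s : nat) (i : 'I_s) (c : R) :
  measurable [set t : s.-tuple (measurableTypeR R) | tnth t i = c].
Proof.
rewrite -[X in measurable X]setTI.
exact: (measurable_tnth i measurableT (measurable_set1 c)).
Qed.

(** Induction on the dimension: the hyperplane is the product of the whole line
    with a hyperplane of one dimension less, or, for the first coordinate, of a
    point with the whole space; in both cases a factor is null. *)
Lemma lebesgue_tuple_hyperplane (R : realType) (s : nat) (j : 'I_s) (c : R) :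
  lebesgue_tuple R s [set t | tnth t j = c] = 0%E.
Proof.
elim: s j => [[]//|s IHs] j /=.
rewrite /lebesgue_tuple_cons /pushforward.
have [i ->|->] := unliftP ord0 j.
  rewrite (_ : _ @^-1` _ = setT `*` [set t | tnth t i = c]); last first.
    by apply/seteqP; split => -[x t] /=; rewrite tnthS => // -[].
  rewrite product_measure1E//; first by rewrite IHs mule0.
  exact: measurable_tnth_eq.
rewrite (_ : _ @^-1` _ = [set c] `*` setT); last first.
  by apply/seteqP; split => -[x t] /=; rewrite tnth0 => // -[].
rewrite product_measure1E//.
by rewrite [X in (X * _)%E](lebesgue_measure_set1 c) mul0e.
Qed.

Lemma lebesgue_vec_hyperplane (R : realType) (s : nat) (j : 'I_s) (c : R) :
  @lebesgue_vec R s [set z : 'cV[R]_s | z j 0 = c] = 0%E.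
Proof.
rewrite /lebesgue_vec /pushforward.
rewrite (_ : _ @^-1` _ = [set t | tnth t j = c]).
  exact: lebesgue_tuple_hyperplane.
by apply/seteqP; split => t /=; rewrite mxE.
Qed.

(** * The optimal value phi as a function of the right-hand side *)

(** phi t is determined by the set of indices of the feasible integer points. *)
Lemma phi_finite_range (R : realType) (m s : nat) (W : 'M[R]_(s, m))
    (q d : 'cV[R]_m) (Y : set 'cV[R]_m) :
  finite_set (Y `&` @integer_points R m) -> finite_set (range (phi W q d Y)).
Proof.
move=> Yfin.
move/finite_seqP : Yfin => [ys Yys].
pose v (B : {set 'I_(size ys)}) :=
  ereal_inf [set (dotv q y)%:E | y in argmin_set d
    [set y | exists2 i, i \in B & y = ys`_i]].
apply: (@sub_finite_set _ _ (range v)); last first.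
  exact/finite_image/finite_finset.
move=> _ [t _ <-].
exists [set i : 'I_(size ys) | [forall j, (W *m ys`_i) j 0 <= t j 0]]%SET => //.
rewrite /v /phi /Psi; congr (ereal_inf [set _ | _ in argmin_set d _]).
apply/seteqP; split => [y [i + ->]|y [Wy]].
  by rewrite inE => /forallP Wi; split => //; rewrite Yys /= mem_nth.
rewrite Yys /= => yys.
have iy : (index y ys < size ys)%N by rewrite index_mem.
exists (Ordinal iy); last by rewrite /= nth_index.
by rewrite inE; apply/forallP => j; rewrite /= nth_index.
Qed.

(** Off the thresholds (W y) i, a small change of t modifies none of the finitely
    many comparisons (W y) i <= t i, hence does not modify the feasible set. *)
Lemma phi_near_constant (R : realType) (m s : nat) (W : 'M[R]_(s, m))
    (q d : 'cV[R]_m) (Y : set 'cV[R]_m) (t : 'cV[R]_s) :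
  finite_set (Y `&` @integer_points R m) ->
  (forall y i, (Y `&` @integer_points R m) y -> t i 0 <> (W *m y) i 0) ->
  \forall t' \near t, phi W q d Y t' = phi W q d Y t.
Proof.
move=> /finite_seqP[ys Yys] tW.
have near_sign : nbhs t [set t' : 'cV[R]_s | forall ki : 'I_(size ys) * 'I_s,
    ((W *m ys`_ki.1) ki.2 0 <= t' ki.2 0) = ((W *m ys`_ki.1) ki.2 0 <= t ki.2 0)].
  refine (@filter_forall _ _ _ _ (nbhs_filter t) _) => -[k i] /=.
  have Ci := @coord_continuous R s 1 i 0.
  have /eqP : t i 0 <> (W *m ys`_k) i 0 by apply: tW; rewrite Yys /= mem_nth.
  set c := (W *m ys`_k) i 0.
  rewrite neq_lt => /orP[tc|ct].
    have : nbhs t [set z : 'cV[R]_s | z i 0 < c] by exact: (Ci t _ (lt_nbhsl tc)).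
    by apply: filterS => z /= zc; rewrite !leNgt zc tc.
  have : nbhs t [set z : 'cV[R]_s | c < z i 0] by exact: (Ci t _ (lt_nbhsr ct)).
  by apply: filterS => z /= zc; rewrite !ltW.
apply: filterS near_sign => t' eqt; rewrite /phi /Psi.
suff -> : lower_feasible W Y t' = lower_feasible W Y t by [].
apply/seteqP; split => y [Wy Yy]; split => // i; have := Wy i.
all: have yys : y \in ys by move: Yy; rewrite Yys.
all: have iy : (index y ys < size ys)%N by rewrite index_mem.
all: by have := eqt (Ordinal iy, i); rewrite /= nth_index// => ->.
Qed.

(** * Continuity of the risk functional *)

Section continuity.
Context (R : realType) (n m s : nat).
Variables (T : 'M[R]_(s, n)) (W : 'M[R]_(s, m)) (q d : 'cV[R]_m).
Variable Y : set 'cV[R]_m.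
Hypothesis Yfin : finite_set (Y `&` @integer_points R m).
Local Notation f := (phi W q d Y).

Lemma phi_continuousE (t : 'cV[R]_s) :
  {for t, continuous f} <-> \forall t' \near t, f t' = f t.
Proof.
have ff := phi_finite_range W q d Yfin.
exact: (finite_range_continuousE t (@ereal_hausdorff R) ff).
Qed.

(** A function constant near t is constant near every point close to t, so that
    phi is continuous on an open set. *)
Lemma measurable_D_phi (x : 'cV[R]_n) : measurable (D_phi T W q d Y x).
Proof.
pose C := [set t | {for t, continuous f}].
have oC : open C.
  rewrite openE => t /phi_continuousE /nbhs_interior; apply: filterS => t' nt'.
  by apply/phi_continuousE; rewrite (nbhs_singleton nt'); exact: nt'.
have -> : D_phi T W q d Y x = ~` ((fun z => T *m x + z) @^-1` C) by [].
apply: measurableC; apply: open_measurable_mx.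
apply: (@open_comp _ _ (fun z : 'cV[R]_s => T *m x + z)) oC => z _.
exact: translation_continuous.
Qed.

Context (disp : measure_display) (Omega : measurableType disp).
Variables (P : probability Omega R) (Z : {RV P >-> 'cV[R]_s}).
Variables (p : R) (p1 : (1 <= p%:E)%E) (risk : LfunType P p1 -> R).

(** The null-set hypothesis enters through the events A k, on which phi is not
    constant on the ball of radius 1/(k+1) around T x + Z w: they decrease to
    the preimage of D_phi x under Z. *)
Lemma Q_R_continuous_at (x : 'cV[R]_n) :
  convex_function [set: LfunType P p1] risk -> ae_nondecreasing risk ->
  distribution P Z (D_phi T W q d Y x) = 0%E ->
  {for x, continuous (Q_R T W q d Z Yfin risk)}.
Proof.
move=> cvx mono D0.
have ff := phi_finite_range W q d Yfin.
pose r (k : nat) : R := k.+1%:R^-1.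
have r0 k : 0 < r k by rewrite invr_gt0.
pose G k := [set t | forall t', ball t (r k) t' -> f t' = f t].
have Gcl k : closed (G k) by exact: (closed_level_erosion (r0 k) ff).
pose A k := [set w | ~ G k (T *m x + Z w)].
have mA k : measurable (A k).
  have -> : A k = Z @^-1` ((fun z => T *m x + z) @^-1` (~` G k)) by [].
  rewrite -[X in measurable X]setTI; apply: (measurable_funPT Z) => //.
  apply: open_measurable_mx.
  apply: (@open_comp _ _ (fun z : 'cV[R]_s => T *m x + z)).
    by move=> z _; exact: translation_continuous.
  exact: closed_openC.
have AD : \bigcap_k A k = Z @^-1` D_phi T W q d Y x.
  apply/seteqP; split => [w Aw|w /= nc k _ Gk].
    move=> /phi_continuousE /nbhs_ballP[e /= e0 ce].
    have [k _ /(_ k (leqnn k)) ke] := near_infty_natSinv_lt (PosNum e0).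
    apply: (Aw k) => // t tk; apply: ce; exact: le_ball (ltW ke) _ tk.
  apply: nc; apply/phi_continuousE.
  by apply/nbhs_ballP; exists (r k) => //=; exact: r0.
have A0 : P (A k) @[k --> \oo] --> 0%E.
  rewrite -D0 /distribution /pushforward -AD.
  apply: nonincreasing_cvg_mu => //.
  - by rewrite (le_lt_trans (probability_le1 _ _))// ltry.
  - exact: bigcap_measurableType.
  - move=> k l kl; apply/subsetPset => w Al Gk; apply: Al => t tl.
    by apply: Gk; apply: le_ball tl; rewrite lef_pV2 ?posrE// ler_nat ltnS.
have [B fB] : exists B, forall t, `|fine (f t)| <= B.
  have /finite_seqP[vs fvs] := ff.
  exists (\sum_(v <- vs) `|fine v|) => t.
  have ft : f t \in vs by have : range f (f t) by []; rewrite fvs.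
  by rewrite (big_rem _ ft)/= lerDl sumr_ge0.
have B0 : 0 <= B by exact: le_trans (fB 0).
apply/(@cvgrPdist_le _ _ _ (nbhs x) (nbhs_filter x)) => e e0.
have [k kX] := @risk_close_off_small_sets _ _ _ _ _ p1 risk
  (recourse T W q d Z p1 Yfin x) A (B + B) e cvx mono mA A0 (addr_ge0 B0 B0) e0.
have := near_mulmx_ball T x (r0 k).
apply: filterS => x' xx'; rewrite distrC; apply: kX => w.
change (`|fine (f (T *m x' + Z w)) - fine (f (T *m x + Z w))|
  <= (B + B) * \1_(A k) w).
have [Aw|/contrapT Gw] := pselect (A k w).
  by rewrite indicE mem_set// mulr1 (le_trans (ler_normB _ _))// lerD.
rewrite (Gw (T *m x' + Z w)) ?subrr ?normr0 ?mulr_ge0 ?addr_ge0//.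
case: xx' => _ xx'; split => // i j; have := xx' i j.
by rewrite -!ball_normE /= !mxE opprD addrACA subrr addr0.
Qed.

End continuity.

(** At a discontinuity, T x + z sits on one of the finitely many thresholds
    (W y) i, so that z lies on the hyperplane z i = (W y - T x) i. *)
Lemma D_phi_lebesgue_null (R : realType) (n m s : nat)
    (T : 'M[R]_(s, n)) (W : 'M[R]_(s, m)) (q d : 'cV[R]_m) (Y : set 'cV[R]_m)
    (disp : measure_display) (Omega : measurableType disp)
    (P : probability Omega R) (Z : {RV P >-> 'cV[R]_s}) (x : 'cV[R]_n) :
  finite_set (Y `&` @integer_points R m) ->
  distribution P Z `<< @lebesgue_vec R s ->
  distribution P Z (D_phi T W q d Y x) = 0%E.
Proof.
move=> Yfin ac; have /finite_seqP[ys Yys] := Yfin.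
pose h (ki : 'I_(size ys) * 'I_s) : R := ((W *m ys`_ki.1) - T *m x) ki.2 0.
pose F ki := Z @^-1` [set z : 'cV[R]_s | z ki.2 0 = h ki].
have F0 ki : P.-negligible (F ki).
  have cl : closed [set z : 'cV[R]_s | z ki.2 0 = h ki].
    have /continuous_closedP Ci := @coord_continuous R s 1 ki.2 0.
    exact: (Ci _ (@closed_eq R (h ki))).
  have mh : measurable [set z : 'cV[R]_s | z ki.2 0 = h ki].
    rewrite -[X in measurable X]setCK; apply: measurableC.
    by apply: open_measurable_mx; exact: closed_openC.
  apply/negligibleP.
    by rewrite -[X in measurable X]setTI; exact: (measurable_funPT Z).
  have L0 : (@lebesgue_vec R s).-null_set [set z : 'cV[R]_s | z ki.2 0 = h ki].
    by apply/measure0_null_setP => //; exact: lebesgue_vec_hyperplane.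
  exact: (ac _ L0 _ mh).
(* The finite union is indexed by nat, through an encoding of the pairs. *)
pose N := \bigcup_k (if unpickle k is Some ki then F ki else set0).
have N0 : P.-negligible N.
  apply: negligible_bigcup => k.
  by case: unpickle => [ki|]; [exact: F0|exact: negligible_set0].
rewrite /distribution /pushforward; apply: measure_negligible.
  rewrite -[X in measurable X]setTI; apply: (measurable_funPT Z) => //.
  exact: measurable_D_phi.
apply: negligibleS N0 => w; apply: contra_notP => Nw.
apply/(phi_continuousE _ _ _ Yfin).
apply: phi_near_constant => // y i; rewrite Yys /= => yys E; apply: Nw.
have iy : (index y ys < size ys)%N by rewrite index_mem.
exists (pickle (Ordinal iy, i)) => //; rewrite pickleK /F /h /= nth_index//.
by move: E; rewrite !mxE => <-; rewrite addrAC subrr add0r.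
Qed.

Theorem theorem4p1 (R : realType) (n m s : nat)
    (T : 'M[R]_(s, n)) (W : 'M[R]_(s, m)) (q d : 'cV[R]_m) (Y : set 'cV[R]_m)
    (disp : measure_display) (Omega : measurableType disp)
    (P : probability Omega R) (Z : {RV P >-> 'cV[R]_s})
    (p : R) (p1 : (1 <= p%:E)%E) (risk : LfunType P p1 -> R)
    (Y0 : Y `&` @integer_points R m !=set0)
    (Yfin : finite_set (Y `&` @integer_points R m)) :
  convex_function [set: LfunType P p1] risk ->
  ae_nondecreasing risk ->
  (forall x, F_Z T W q d Y Z x ->
     distribution P Z (D_phi T W q d Y x) = 0%E ->
     Q_R T W q d Z Yfin risk @ within (F_Z T W q d Y Z) (nbhs x) -->
       Q_R T W q d Z Yfin risk x) /\
  (distribution P Z `<< @lebesgue_vec R s ->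
     {within F_Z T W q d Y Z, continuous (Q_R T W q d Z Yfin risk)} /\
     (F_Z T W q d Y Z !=set0 -> compact (F_Z T W q d Y Z) ->
        exists2 x, F_Z T W q d Y Z x &
          forall x', F_Z T W q d Y Z x' ->
            Q_R T W q d Z Yfin risk x <= Q_R T W q d Z Yfin risk x')).
Proof.
move=> cvx mono; split=> [x _ D0|ac].
  apply: cvg_trans (Q_R_continuous_at cvx mono D0).
  exact: (cvg_app _ (@cvg_within _ (nbhs x) _ _)).
have cQ : continuous (Q_R T W q d Z Yfin risk).
  by move=> x; apply: Q_R_continuous_at => //; exact: D_phi_lebesgue_null.
have cQF : {within F_Z T W q d Y Z, continuous (Q_R T W q d Z Yfin risk)}.
  exact: continuous_subspaceT.
split=> // F0 cF.
have [x xF xmin] := compact_EVT_min F0 cF cQF.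
exists x => [|x' x'F]; first exact/set_mem.
by apply: xmin; exact/mem_set.
Qed.
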